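(* Let $\mathbb{C}$ be a small coconfluent category and let $P$ be an atomic sheaf on $\mathbb{C}$. For each object $X$ of $\mathbb{C}$ define $$\sim_P(X) := \{(x,x') \in P(X)\times P(X) \mid \exists Z\ \exists u,u' \colon Z \to X \text{ in } \mathbb{C}.\ x\cdot u = x'\cdot u'\}.$$ Then: (i) for every morphism $f\colon Y\to X$ in $\mathbb{C}$ and every $(x,x')\in \sim_P(X)$ we have $(x\cdot f, x'\cdot f)\in \sim_P(Y)$; (ii) for every morphism $f\colon Y \to X$ and every $(x,x')\in P(X)\times P(X)$, if $(x\cdot f,x'\cdot f)\in\sim_P(Y)$ then $(x,x')\in\sim_P(X)$; so $\sim_P$ is a subsheaf of $P\times P$. Moreover (iii) for every object $X$, $\sim_P(X)$ is an equivalence relation on $P(X)$.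
   Context: A presheaf on a small category $\mathbb{C}$ is a functor $P\colon \mathbb{C}^{op}\to\mathbf{Set}$; for $f\colon Y\to X$ and $x\in P(X)$ write $x\cdot f := P(f)(x)\in P(Y)$. $\mathbb{C}$ is coconfluent if every cospan $X\xrightarrow{f} Z\xleftarrow{g} Y$ admits a span $X\xleftarrow{u} W\xrightarrow{v} Y$ with $f\circ u = g\circ v$. For $c\colon Y\to X$, an element $y\in P(Y)$ is $c$-invariant if $y\cdot d = y\cdot e$ for all $d,e\colon Z\to Y$ with $c\circ d = c\circ e$; an element $x\in P(X)$ is a $c$-descendent of $y$ if $y = x\cdot c$. $P$ is an atomic sheaf if for every $c\colon Y\to X$ every $c$-invariant $y\in P(Y)$ has a unique $c$-descendent. The product presheaf $P\times P$ is computed pointwise, $(x,x')\cdot f = (x\cdot f,x'\cdot f)$. For a sheaf $P$, a family of subsets $Q(X)\subseteq P(X)$ determines a subsheaf exactly when conditions of the form (i) (closure under restriction) and (ii) (reflection along restriction) hold. *)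

(* Defs.v *)
From Stdlib Require Import RelationClasses ProofIrrelevance.

Set Implicit Arguments.
Unset Strict Implicit.

Declare Scope cat_scope.
Open Scope cat_scope.

Record category := Category {
  obj :> Type;
  hom : obj -> obj -> Type;
  idm : forall X, hom X X;
  comp : forall X Y Z, hom Y Z -> hom X Y -> hom X Z;
  comp_idl : forall X Y (f : hom X Y), comp (idm Y) f = f;
  comp_idr : forall X Y (f : hom X Y), comp f (idm X) = f;
  comp_assoc : forall W X Y Z (h : hom Y Z) (g : hom X Y) (f : hom W X),
    comp h (comp g f) = comp (comp h g) f
}.
Arguments hom {c} X Y : rename.
Arguments idm {c} X.
Arguments comp {c X Y Z} g f : rename.
Notation "g ∘ f" := (comp g f) (at level 40, left associativity) : cat_scope.

Definition coconfluent (C : category) : Prop :=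
  forall (X Y Z : C) (f : hom X Z) (g : hom Y Z),
    exists (W : C) (u : hom W X) (v : hom W Y), f ∘ u = g ∘ v.

(* A functor from the opposite category of C to sets, with types under Leibniz
   equality as sets; [restr f x] is P(f)(x). *)
Record presheaf (C : category) := Presheaf {
  elt :> C -> Type;
  restr : forall X Y : C, hom Y X -> elt X -> elt Y;
  restr_id : forall (X : C) (x : elt X), restr (idm X) x = x;
  restr_comp : forall (X Y Z : C) (f : hom Y X) (g : hom Z Y) (x : elt X),
    restr (f ∘ g) x = restr g (restr f x)
}.
Arguments restr {C} p {X Y} f x.
Notation "x ⋅ f" := (restr _ f x) (at level 40, left associativity) : cat_scope.

Definition invariant (C : category) (P : presheaf C) (X Y : C) (c : hom Y X)
    (y : P Y) : Prop :=
  forall (Z : C) (d e : hom Z Y), c ∘ d = c ∘ e -> y ⋅ d = y ⋅ e.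

Definition descendent (C : category) (P : presheaf C) (X Y : C) (c : hom Y X)
    (y : P Y) (x : P X) : Prop :=
  y = x ⋅ c.

Definition atomic_sheaf (C : category) (P : presheaf C) : Prop :=
  forall (X Y : C) (c : hom Y X) (y : P Y),
    invariant c y -> exists! x : P X, descendent c y x.

Definition prod_presheaf (C : category) (P Q : presheaf C) : presheaf C.
Proof.
refine {| elt := fun X => (P X * Q X)%type;
          restr := fun X Y f p => (fst p ⋅ f, snd p ⋅ f) |}.
- intros X [x y]; simpl; now rewrite !restr_id.
- intros X Y Z f g [x y]; simpl; now rewrite !restr_comp.
Defined.

Definition restr_closed (C : category) (P : presheaf C)
    (Q : forall X : C, P X -> Prop) : Prop :=
  forall (X Y : C) (f : hom Y X) (x : P X), Q X x -> Q Y (x ⋅ f).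

Definition subpresheaf (C : category) (P : presheaf C)
    (Q : forall X : C, P X -> Prop) (HQ : restr_closed Q) : presheaf C.
Proof.
refine {| elt := fun X => {x : P X | Q X x};
          restr := fun X Y f x =>
            exist (Q Y) (proj1_sig x ⋅ f) (HQ X Y f _ (proj2_sig x)) |}.
- intros X [x qx]; apply subset_eq_compat; apply restr_id.
- intros X Y Z f g [x qx]; apply subset_eq_compat; apply restr_comp.
Defined.

(* The family of subsets Q, with the restriction maps inherited from P, is a
   presheaf that is itself an atomic sheaf. *)
Definition is_subsheaf (C : category) (P : presheaf C)
    (Q : forall X : C, P X -> Prop) : Prop :=
  exists HQ : restr_closed Q, atomic_sheaf (subpresheaf HQ).

Definition sim (C : category) (P : presheaf C) (X : C)
    (p : prod_presheaf P P X) : Prop :=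
  exists (Z : C) (u u' : hom Z X), fst p ⋅ u = snd p ⋅ u'.
Arguments sim {C} P X p.

(* Main.v *)
Require Import Defs.
From Stdlib Require Import RelationClasses ProofIrrelevance.

(** A pair is related when its members agree after restriction along two maps from a common object.
    Such witnesses move backwards along [f] by completing cospans ([sim_restr]), forwards by
    composing with [f] ([sim_reflect]), and chain by completing a cospan at the middle element.
    Closure and reflection then cut a subsheaf out of the product sheaf. *)

Lemma prod_atomic_sheaf (C : category) (P Q : presheaf C) :
  atomic_sheaf P -> atomic_sheaf Q -> atomic_sheaf (prod_presheaf P Q).
Proof.
intros HP HQ X Y c [y z] Hyz.
destruct (HP X Y c y) as [x [Hx Ux]].
{ intros Z d e Hde; exact (f_equal fst (Hyz Z d e Hde)). }
destruct (HQ X Y c z) as [w [Hw Uw]].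
{ intros Z d e Hde; exact (f_equal snd (Hyz Z d e Hde)). }
exists (x, w); split.
- exact (f_equal2 pair Hx Hw).
- intros [x1 w1] H; apply f_equal2.
  + exact (Ux x1 (f_equal fst H)).
  + exact (Uw w1 (f_equal snd H)).
Qed.

(** An element of [Q] invariant in the subpresheaf is invariant in [P], so it has a unique
    descendent there; reflection along [c] puts that descendent in [Q]. *)
Lemma is_subsheaf_closed_reflecting (C : category) (P : presheaf C)
    (Q : forall X : C, P X -> Prop) :
  atomic_sheaf P -> restr_closed Q ->
  (forall (X Y : C) (f : hom Y X) (x : P X), Q Y (x ⋅ f) -> Q X x) ->
  is_subsheaf Q.
Proof.
intros HP Qcl Qrefl; exists Qcl.
intros X Y c [y Qy] Hy.
destruct (HP X Y c y) as [x [Hx Ux]].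
{ intros Z d e Hde; exact (f_equal (@proj1_sig _ _) (Hy Z d e Hde)). }
assert (Qx : Q X x).
{ apply (Qrefl X Y c); rewrite <- Hx; exact Qy. }
exists (exist _ x Qx); split.
- apply subset_eq_compat; exact Hx.
- intros [x1 Qx1] H; apply subset_eq_compat.
  exact (Ux x1 (f_equal (@proj1_sig _ _) H)).
Qed.

Lemma sim_restr (C : category) (HC : coconfluent C) (P : presheaf C)
    (X Y : C) (f : hom Y X) (x x' : P X) :
  sim P X (x, x') -> sim P Y (x ⋅ f, x' ⋅ f).
Proof.
intros [Z [u [u' E]]]; simpl in E.
(* First factor [u] through [f] after precomposing with [a], then do the same for [u' ∘ a]. Both
   sides now live over [V], where [E] restricted along [a ∘ c] gives the equality. *)
destruct (HC _ _ _ u f) as [W [a [b Hab]]].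
destruct (HC _ _ _ (u' ∘ a) f) as [V [c [d Hcd]]].
exists V, (b ∘ c), d; simpl.
now rewrite <- !restr_comp, <- Hcd, comp_assoc, <- Hab, !restr_comp, E.
Qed.

Lemma sim_reflect (C : category) (P : presheaf C)
    (X Y : C) (f : hom Y X) (x x' : P X) :
  sim P Y (x ⋅ f, x' ⋅ f) -> sim P X (x, x').
Proof.
intros [Z [u [u' E]]]; exists Z, (f ∘ u), (f ∘ u'); simpl in *.
now rewrite !restr_comp.
Qed.

Lemma sim_equivalence (C : category) (HC : coconfluent C) (P : presheaf C)
    (X : C) : Equivalence (fun x x' : P X => sim P X (x, x')).
Proof.
split.
- intros x; now exists X, (idm X), (idm X).
- intros x x' [Z [u [u' E]]]; now exists Z, u', u.
- intros x x' x'' [Z [u [u' E]]] [W [v [v' F]]]; simpl in E, F.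
  (* Both [u'] and [v] act on the middle element [x']; over [V] their restrictions of it coincide,
     which links [E] to [F]. *)
  destruct (HC _ _ _ u' v) as [V [a [b Hab]]].
  exists V, (u ∘ a), (v' ∘ b); simpl.
  now rewrite !restr_comp, E, <- F, <- !restr_comp, Hab.
Qed.

Theorem theorem5p1 (C : category) (HC : coconfluent C)
    (P : presheaf C) (HP : atomic_sheaf P) :
  (forall (X Y : C) (f : hom Y X) (x x' : P X),
     sim P X (x, x') -> sim P Y (x ⋅ f, x' ⋅ f)) /\
  (forall (X Y : C) (f : hom Y X) (x x' : P X),
     sim P Y (x ⋅ f, x' ⋅ f) -> sim P X (x, x')) /\
  is_subsheaf (P := prod_presheaf P P) (sim P) /\
  (forall X : C, Equivalence (fun x x' : P X => sim P X (x, x'))).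
Proof.
split; [exact (sim_restr C HC P)|].
split; [exact (sim_reflect C P)|].
split; [|exact (sim_equivalence C HC P)].
apply is_subsheaf_closed_reflecting.
- now apply prod_atomic_sheaf.
- intros X Y f [x x']; apply sim_restr, HC.
- intros X Y f [x x']; apply sim_reflect.
Qed.
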